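(* For every constant $C>0$ there is a constant $c>0$ depending only on $C$ (in particular not on the dimension, the means or the covariance) such that the following holds. Let $d\ge 1$, let $\Sigma\in\mathbb{R}^{d\times d}$ be positive definite, and let $\mu_0,\mu_1,\mu_0',\mu_1'\in\mathbb{R}^d$ be not all equal. Consider the mixtures $$f_{\mu_0,\mu_1}=\tfrac12\mathcal N(\mu_0,\Sigma)+\tfrac12\mathcal N(\mu_1,\Sigma),\qquad f_{\mu_0',\mu_1'}=\tfrac12\mathcal N(\mu_0',\Sigma)+\tfrac12\mathcal N(\mu_1',\Sigma).$$ Define $S_1=\{\mu_1-\mu_0,\ \mu_1'-\mu_0'\}$, $S_2=\{\mu_0'-\mu_0,\ \mu_1'-\mu_1\}$, $S_3=\{\mu_0'-\mu_1,\ \mu_1'-\mu_0\}$, and for $i=1,2,3$ let $v_i\in\operatorname{argmax}_{s\in S_i}\|s\|_2$. Let $\mathcal U$ be the linear span of $v_1,v_2,v_3$ and let $$\lambda_{\Sigma,\mathcal U}=\max_{u\in\mathcal U,\ \|u\|_2=1}u^T\Sigma u .$$ (i) If $\|v_1\|_2\ge \tfrac12\min(\|v_2\|_2,\|v_3\|_2)$ and $\sqrt{\lambda_{\Sigma,\mathcal U}}\ge C\|v_1\|_2$, then $$\|f_{\mu_0,\mu_1}-f_{\mu_0',\mu_1'}\|_{\mathsf{TV}}\ \ge\ c\,\min\Big(1,\ \frac{\|v_1\|_2\,\min(\|v_2\|_2,\|v_3\|_2)}{\lambda_{\Sigma,\mathcal U}}\Big).$$ (ii) Otherwise (i.e. if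 at least one of the two conditions in (i) fails), $$\|f_{\mu_0,\mu_1}-f_{\mu_0',\mu_1'}\|_{\mathsf{TV}}\ \ge\ c\,\min\Big(1,\ \frac{\min(\|v_2\|_2,\|v_3\|_2)}{\sqrt{\lambda_{\Sigma,\mathcal U}}}\Big).$$
   Context: $\mathcal N(\mu,\Sigma)$ is the $d$-dimensional Gaussian distribution with mean $\mu$ and covariance matrix $\Sigma$. The two mixtures share the same covariance matrix $\Sigma$. The total variation distance between two distributions $f,f'$ on the same measurable space is $\|f-f'\|_{\mathsf{TV}}=\sup_{A}\,(f(A)-f'(A))$, the supremum being over all measurable sets $A$. If the maximum over $S_i$ is attained by both elements, $v_i$ may be either of them. *)

(* Defs.v *)
From HB Require Import structures.
From mathcomp Require Import all_boot all_order all_algebra.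
From mathcomp Require Import all_classical all_reals all_analysis.

Set Implicit Arguments.
Unset Strict Implicit.
Unset Printing Implicit Defensive.

Import Order.TTheory GRing.Theory Num.Theory.

Local Open Scope classical_set_scope.
Local Open Scope ring_scope.

Section linear_algebra.
Context {R : realType} {d : nat}.
Implicit Types (u v : 'cV[R]_d) (A : 'M[R]_d).

(* The library norm on matrices is the max norm, hence this definition. *)
Definition norm2 u : R := Num.sqrt (\sum_(i < d) u i 0 ^+ 2).

Definition qform A u : R := (u^T *m A *m u) 0 0.

Definition posdefmx A : Prop :=
  A^T = A /\ forall u, u != 0 -> 0 < qform A u.

Definition argmax_norm2 (S : set 'cV[R]_d) v : Prop :=
  S v /\ forall s, S s -> norm2 s <= norm2 v.

(* The unit sphere of U is compact, and nonempty if U != 0, in which case this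
   supremum is a maximum. *)
Definition max_qform A (U : {vspace 'cV[R]_d}) : R :=
  sup [set qform A u | u in [set u | u \in U /\ norm2 u = 1]].

End linear_algebra.

(* R^n is the type of n-tuples over R, whose library sigma-algebra is generated
   by the coordinates, i.e. the Borel sigma-algebra of R^n. *)
Notation Rtuple R n := (n.-tuple (measurableTypeR R)).

Section lebesgue_Rn.
Context {R : realType}.
Local Open Scope ereal_scope.

Definition tuple_cons n (p : measurableTypeR R * Rtuple R n) : Rtuple R n.+1 :=
  [tuple of p.1 :: p.2].

Lemma measurable_tuple_cons n : measurable_fun [set: _] (@tuple_cons n).
Proof. exact: (measurable_cons measurable_fst measurable_snd). Qed.

Section prod_cons.
Variables (n : nat) (m : {sigma_finite_measure set (Rtuple R n) -> \bar R}).

Definition prod_cons : set (Rtuple R n.+1) -> \bar R :=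
  pushforward (@lebesgue_measure R \x m) (@tuple_cons n).

Let p : {measure set _ -> \bar R} := (@lebesgue_measure R \x m)%E.

Let prod_cons0 : prod_cons set0 = 0.
Proof. by rewrite /prod_cons /pushforward preimage_set0 measure0. Qed.

Let prod_cons_ge0 A : 0 <= prod_cons A.
Proof. exact: (measure_ge0 p). Qed.

Let prod_cons_sigma_additive : semi_sigma_additive prod_cons.
Proof.
move=> F mF tF mUF; rewrite /prod_cons /pushforward preimage_bigcup.
have mpre A : measurable A -> measurable (@tuple_cons n @^-1` A).
  by move=> mA; rewrite -[X in measurable X]setTI; exact: measurable_tuple_cons.
apply: (@measure_semi_sigma_additive _ _ _ p).
- by move=> k; exact: mpre.
- apply/trivIsetP => /= i j _ _ ij; rewrite -preimage_setI.
  by move/trivIsetP : tF => /(_ _ _ _ _ ij) ->//; rewrite preimage_set0.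
- by rewrite -preimage_bigcup; exact: mpre.
Qed.

HB.instance Definition _ := isMeasure.Build _ _ _ prod_cons
  prod_cons0 prod_cons_ge0 prod_cons_sigma_additive.

Let prod_cons_sigma_finite : sigma_finite setT prod_cons.
Proof.
have /sigma_finiteP[F [TF ndF Foo]] := sigma_finiteT (@lebesgue_measure R).
have /sigma_finiteP[G [TG ndG Goo]] := sigma_finiteT m.
pose h (t : Rtuple R n.+1) : measurableTypeR R * Rtuple R n :=
  (thead t, [tuple of behead t]).
have mh : measurable_fun [set: _] h.
  by apply/measurable_fun_pair; [exact: measurable_tnth|exact: measurable_behead].
have hK z : h (tuple_cons z) = z.
  by case: z => x t; congr pair; exact/val_inj.
exists (fun k => h @^-1` (F k `*` G k)).
  rewrite -preimage_bigcup (_ : \bigcup_k _ = setT) ?preimage_setT//.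
  rewrite -setXTT TF TG predeqE => -[x y]; split.
    by move=> [k _ []/= ? ?]; split; exists k.
  move=> [/= [i _ Fix] [j _ Gjy]]; exists (maxn i j) => //; split.
  - by move: x Fix; exact/subsetPset/ndF/leq_maxl.
  - by move: y Gjy; exact/subsetPset/ndG/leq_maxr.
move=> k; have [mF Fk] := Foo k; have [mG Gk] := Goo k; split.
  by rewrite -[X in measurable X]setTI; apply: mh => //; exact: measurableX.
rewrite /prod_cons /pushforward -comp_preimage.
rewrite (_ : h \o _ = id) ?preimage_id; last exact/funext.
by rewrite product_measure1E// lte_mul_pinfty// ge0_fin_numE.
Qed.

HB.instance Definition _ := Measure_isSigmaFinite.Build _ _ _ prod_cons
  prod_cons_sigma_finite.

End prod_cons.

(* n-dimensional Lebesgue measure: the n-fold product of lebesgue_measure. *)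
Fixpoint lebesgue_Rn (n : nat) :
    {sigma_finite_measure set (Rtuple R n) -> \bar R} :=
  match n with
  | 0 => \d_([tuple] : Rtuple R 0)
  | k.+1 => prod_cons (lebesgue_Rn k)
  end.

End lebesgue_Rn.

Section gaussian_mixtures.
Context {R : realType} {d : nat}.
Implicit Types (mu : 'cV[R]_d) (Sigma : 'M[R]_d).

Definition gaussian_pdf mu Sigma (x : 'cV[R]_d) : R :=
  (Num.sqrt ((2 * pi) ^+ d * \det Sigma))^-1 *
  expR (- (qform (invmx Sigma) (x - mu) / 2)).

(* The distribution N(mu, Sigma), for Sigma positive definite. *)
Definition gaussian mu Sigma (A : set (Rtuple R d)) : \bar R :=
  \int[lebesgue_Rn d]_(x in A) (gaussian_pdf mu Sigma (\col_i tnth x i))%:E.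

Definition gaussian_mixture2 mu0 mu1 Sigma (A : set (Rtuple R d)) : \bar R :=
  (2^-1%:E * gaussian mu0 Sigma A + 2^-1%:E * gaussian mu1 Sigma A)%E.

End gaussian_mixtures.

Definition tv_dist {R : realType} {disp : measure_display}
    {T : measurableType disp} (f g : set T -> \bar R) : \bar R :=
  ereal_sup [set (f A - g A)%E | A in measurable].

(* Main.v *)
Require Import Defs.
From mathcomp Require Import all_boot all_order all_algebra.
From mathcomp Require Import all_classical all_reals all_analysis.
From mathcomp Require Import measurable_realfun ring lra.

(* If w^T Sigma w <= 1/2, testing against the Gaussian bump
   exp (- (w^T x - c)^2 / (2 s)) with s = 1 - w^T Sigma w turns N(mu, Sigma) into
   sqrt s * G (w^T mu - c), G u = exp (- u^2 / 2), so the total variation distance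
   dominates, for every c, a constant times
     |G (q0 - c) + G (q1 - c) - G (p0 - c) - G (p1 - c)|,
   where p0, p1, q0, q1 are the projections of the four means on w. If the
   leftmost point is far from the points of the other pair, take c there;
   otherwise put c a few units to its left, so that u |-> G (u - c) is decreasing
   and strictly convex on the four points.
   Finally w is taken in U so that the projections of v1, v2, v3 on w are
   simultaneously comparable with their norms divided by sqrt lambda: up to
   scaling, w is a signed sum of the v_i / |v_i| of maximal norm. *)

Set Implicit Arguments.
Unset Strict Implicit.
Unset Printing Implicit Defensive.

Import Order.TTheory GRing.Theory Num.Theory.

Local Open Scope classical_set_scope.
Local Open Scope ring_scope.

(** * Separation of Gaussian bumps on the line *)

Section one_dim.
Context {R : realType}.
Implicit Types (u c p q L m e W : R).

Definition bell u : R := expR (- (u ^+ 2 / 2)).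

Lemma bell_gt0 u : 0 < bell u. Proof. exact: expR_gt0. Qed.

Lemma bell_le1 u : bell u <= 1.
Proof. by rewrite /bell -expR0 ler_expR oppr_le0 divr_ge0// sqr_ge0. Qed.

Lemma bellN u : bell (- u) = bell u.
Proof. by rewrite /bell sqrrN. Qed.

Lemma bell_le (u v : R) : u ^+ 2 <= v ^+ 2 -> bell v <= bell u.
Proof. by move=> uv; rewrite /bell ler_expR; lra. Qed.

Lemma bell2_le : bell 2 <= 4^-1.
Proof.
rewrite (_ : bell 2 = (expR (1 + 1))^-1); last first.
  by rewrite /bell -expRN; congr expR; field.
rewrite lef_pV2 ?posrE ?expR_gt0//= expRD.
by have := expR_ge1Dx (1 : R); nra.
Qed.

(** Here [bell (4 - m) = bell 4 * exp (2 x)]. Bounding [exp (2 x)] by [(1 + x)^2] rather than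
    [1 + 2 x] keeps a positive quadratic term in [m], the trace of convexity. *)
Lemma bell4_shiftl m : 0 <= m <= 2 ->
  bell 4 * (1 + 4 * m + 7 / 4 * m ^+ 2) <= bell (4 - m).
Proof.
move=> /andP[m0 m2].
set x := (4 * m - m ^+ 2 / 2) / 2.
have -> : bell (4 - m) = bell 4 * (expR x * expR x).
  by rewrite /bell -!expRD; congr expR; rewrite /x; field.
rewrite ler_pM2l ?bell_gt0//.
have x1 := expR_ge1Dx x.
have x0 : 3 / 2 * m <= x by rewrite /x; nra.
have -> : 1 + 4 * m + 7 / 4 * m ^+ 2 = 1 + 2 * x + 9 / 4 * m ^+ 2.
  by rewrite /x; field.
nra.
Qed.

(** The bounds [1 - exp (- y) <= y] and [bell (4 + L) <= bell 4 / (1 + 4 L)] replace the slope 4 by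
    [(4 + L) / (1 + 4 L) = 4 - 15 L / (1 + 4 L)]: the bell flattens as [L] grows. *)
Lemma bell4_shiftr L e : 0 <= L -> 0 <= e ->
  bell (4 + L) - bell (4 + L + e) <=
  bell 4 * (4 * e - 15 * (L / (1 + 4 * L)) * e + e ^+ 2 / 2).
Proof.
move=> L0 e0; set y := (4 + L) * e + e ^+ 2 / 2.
have -> : bell (4 + L + e) = bell (4 + L) * expR (- y).
  by rewrite /bell -!expRD; congr expR; rewrite /y; field.
have y0 : 0 <= y by rewrite /y; nra.
have d0 : 0 < 1 + 4 * L by lra.
have bL : bell (4 + L) <= bell 4 / (1 + 4 * L).
  have -> : bell (4 + L) = bell 4 / expR (4 * L + L ^+ 2 / 2).
    by rewrite /bell -expRN -!expRD; congr expR; field.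
  rewrite ler_pM2l ?bell_gt0// lef_pV2 ?posrE ?expR_gt0//.
  by apply: le_trans (expR_ge1Dx _); nra.
have ey := expR_ge1Dx (- y).
apply: (@le_trans _ _ (bell (4 + L) * y)).
  by have := bell_gt0 (4 + L); nra.
apply: (le_trans (ler_wpM2r y0 bL)).
rewrite (_ : _ * y = bell 4 * (y / (1 + 4 * L))); last by rewrite mulrAC -mulrA.
rewrite ler_pM2l ?bell_gt0//.
have -> : y / (1 + 4 * L) =
    4 * e - 15 * (L / (1 + 4 * L)) * e + e ^+ 2 / 2 / (1 + 4 * L).
  by rewrite /y; field; rewrite gt_eqF.
rewrite lerD2l ler_pdivrMr//; nra.
Qed.

Definition bell_gap c p0 p1 q0 q1 :=
  bell (q0 - c) + bell (q1 - c) - bell (p0 - c) - bell (p1 - c).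

(** [m] stands for a displacement between the pairs, [W] for the larger spread within a pair. The
    product bound is the general one; the bound linear in [m] serves when the spread is comparable
    to the displacement. *)
Definition bell_separated m W p0 p1 q0 q1 := exists c,
  bell 4 / 4 * (Num.min 1 m * Num.min 1 W) <= `|bell_gap c p0 p1 q0 q1| /\
  (W <= 3 / 2 * m ->
   bell 4 / 4 * Num.min 1 m <= `|bell_gap c p0 p1 q0 q1|).

(** The leftmost point [p - m] is in the second pair and the right ends differ by at most [m], so
    what the second pair gains on the left outweighs what it may lose on the right. *)
Lemma bell_separated_sorted L m e p : 0 <= L -> `|e| <= m ->
  bell_separated m (L + m + e) p (p + L) (p - m) (p + L + e).
Proof.
move=> L0; rewrite ler_norml => /andP[me em].
have [m2|m2] := leP 2 m.
  (* At the leftmost point the bell is 1, while the two points of the first pair are at distance at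
     least 2 and contribute at most 1/4 each. *)
  exists (p - m).
  have F0 : bell 4 / 4 <= `|bell_gap (p - m) p (p + L) (p - m) (p + L + e)|.
    apply: le_trans (ler_norm _); rewrite /bell_gap subrr.
    have h1 : bell (p - (p - m)) <= bell 2 by apply: bell_le; nra.
    have h2 : bell (p + L - (p - m)) <= bell 2 by apply: bell_le; nra.
    have h3 := bell_gt0 (p + L + e - (p - m)).
    have h4 := bell2_le; have h5 := bell_le1 4.
    have -> : bell 0 = 1 by rewrite /bell expr0n/= mul0r oppr0 expR0.
    lra.
  have b4 := bell_gt0 4.
  have m1 : Num.min 1 m = 1 by rewrite min_l//; lra.
  have W1 : Num.min 1 (L + m + e) <= 1 by rewrite ge_min lexx.
  rewrite m1 mul1r mulr1; split => [|_ //].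
  apply: le_trans F0; rewrite ler_piMr//; lra.
have m0 : 0 <= m by lra.
(* Seen from this centre all four points lie more than 2 to the right, past the inflection point 1
   of [bell]. *)
exists (p - 4).
have [F1 F2] : bell 4 / 4 * (Num.min 1 m * Num.min 1 (L + m + e)) <=
    bell_gap (p - 4) p (p + L) (p - m) (p + L + e) /\
  (L + m + e <= 3 / 2 * m ->
   bell 4 / 4 * Num.min 1 m <= bell_gap (p - 4) p (p + L) (p - m) (p + L + e)).
  rewrite /bell_gap.
  have -> : p - m - (p - 4) = 4 - m by ring.
  have -> : p + L + e - (p - 4) = 4 + L + e by ring.
  have -> : p - (p - 4) = 4 by ring.
  have -> : p + L - (p - 4) = 4 + L by ring.
  have b4 := bell_gt0 4.
  have h1 : bell 4 * (1 + 4 * m + 7 / 4 * m ^+ 2) <= bell (4 - m).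
    by apply: bell4_shiftl; lra.
  set x := Num.min 1 m; set w := Num.min 1 (L + m + e).
  have [x0 xm] : 0 <= x /\ x <= m.
    by rewrite /x ge_min le_min lexx orbT m0 ler01.
  have [w1 w0 wW] : [/\ w <= 1, 0 <= w & w <= L + m + e].
    by rewrite /w !ge_min le_min !lexx orbT ler01/=; split => //; lra.
  (* For [e <= 0] nothing is lost on the right and the gain on the left suffices. *)
  have [e0|e0] := leP e 0.
    have h2 : bell (4 + L) <= bell (4 + L + e).
      by apply: bell_le; rewrite ler_pXn2r ?nnegrE//; lra.
    suff h : bell 4 / 4 * x <= bell (4 - m) - bell 4.
      split => [|_]; last lra.
      apply: (@le_trans _ _ (bell 4 / 4 * x)); last lra.
      by rewrite ler_pM2l ?divr_gt0// ler_piMr.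
    have : bell 4 * (4 * x) <= bell 4 * (4 * m + 7 / 4 * m ^+ 2).
      by rewrite ler_pM2l//; nra.
    nra.
  have h2 := bell4_shiftr L0 (ltW e0).
  set z := L / (1 + 4 * L) in h2.
  have z0 : 0 <= z by rewrite /z divr_ge0//; lra.
  (* Gain minus loss in units of [bell 4]; since [e^2 <= m^2], the coefficient of [m^2] is at least
     [7/4 - 1/2 = 5/4]. *)
  suff [h3 h4] : x * w / 4 <= 4 * (m - e) + 5 / 4 * m ^+ 2 + 15 * z * e /\
     (L + m + e <= 3 / 2 * m -> x / 4 <= 4 * (m - e) + 5 / 4 * m ^+ 2 + 15 * z * e).
    have h5 : bell 4 * (4 * (m - e) + 5 / 4 * m ^+ 2 + 15 * z * e) <=
      bell (4 - m) + bell (4 + L + e) - bell 4 - bell (4 + L).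
      have : e ^+ 2 <= m ^+ 2 by nra.
      nra.
    split => [|H]; apply: le_trans h5.
      by rewrite (_ : _ * _ = bell 4 * (x * w / 4)) ?ler_pM2l//; field.
    by rewrite (_ : _ * _ = bell 4 * (x / 4)) ?ler_pM2l//; [exact: h4|field].
  have ze : 0 <= z * e by rewrite mulr_ge0// ltW.
  have xw : x * w <= m * w by exact: ler_wpM2r.
  (* If [L + m + e <= 3/2 m] then [e <= m / 2], and [4 (m - e)] suffices. *)
  split; last by nra.
  have [em2|em2] := leP e (m / 2); first by nra.
  have mw : m * w <= m by nra.
  (* Now [e > m / 2]. If [L < w / 2] then [m > w / 4] and the term in [m^2] suffices; otherwise
     [z >= w / 10] and the term [15 z e] does. *)
  have [LW|LW] := leP (w / 2) L; last by nra.
  suff : w / 10 <= z by nra.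
  rewrite /z ler_pdivlMr; last lra.
  have [L1|L1] := leP L 1; nra.
split => [|H].
  exact: le_trans F1 (ler_norm _).
exact: le_trans (F2 H) (ler_norm _).
Qed.

Lemma bell_separatedC m W p0 p1 q0 q1 :
  bell_separated m W q0 q1 p0 p1 -> bell_separated m W p0 p1 q0 q1.
Proof.
move=> [c H]; exists c.
rewrite (_ : bell_gap c p0 p1 q0 q1 = - bell_gap c q0 q1 p0 p1) ?normrN//.
by rewrite /bell_gap; ring.
Qed.

(** Reflection reverses the line, so each pair is listed backwards to stay sorted. *)
Lemma bell_separatedN m W p0 p1 q0 q1 :
  bell_separated m W (- p1) (- p0) (- q1) (- q0) -> bell_separated m W p0 p1 q0 q1.
Proof.
move=> [c H]; exists (- c).
rewrite (_ : bell_gap _ p0 p1 q0 q1 = bell_gap c (- p1) (- p0) (- q1) (- q0))//.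
have E a : bell (a - - c) = bell (- a - c).
  by rewrite -bellN opprB addrC.
by rewrite /bell_gap !E; ring.
Qed.

Lemma bell_separated_swapl m W p0 p1 q0 q1 :
  bell_separated m W p1 p0 q0 q1 -> bell_separated m W p0 p1 q0 q1.
Proof.
move=> [c H]; exists c.
rewrite (_ : bell_gap c p0 p1 q0 q1 = bell_gap c p1 p0 q0 q1)//.
by rewrite /bell_gap; ring.
Qed.

Lemma bell_separated_le m m' W p0 p1 q0 q1 : 0 <= W -> m' <= m ->
  bell_separated m W p0 p1 q0 q1 -> bell_separated m' W p0 p1 q0 q1.
Proof.
move=> W0 mm [c [H1 H2]]; exists c.
have b4 := bell_gt0 4.
have M : Num.min 1 m' <= Num.min 1 m.
  by rewrite le_min !ge_min lexx mm orbT.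
have W1 : 0 <= Num.min 1 W by rewrite le_min ler01.
split => [|H].
  apply: le_trans H1; rewrite ler_pM2l ?divr_gt0//; exact: ler_wpM2r.
apply: le_trans (H2 _); last lra.
by rewrite ler_pM2l ?divr_gt0.
Qed.

(** A reflection makes the displacement of the left ends the larger one, and exchanging the pairs
    makes [q0] the leftmost point. *)
Lemma bell_separated_ordered m p0 p1 q0 q1 : p0 <= p1 -> q0 <= q1 ->
  (m <= `|q0 - p0|) || (m <= `|q1 - p1|) ->
  bell_separated m (Num.max `|p1 - p0| `|q1 - q0|) p0 p1 q0 q1.
Proof.
wlog l : p0 p1 q0 q1 / `|q1 - p1| <= `|q0 - p0| => [H|].
  have [/H//|l] := leP `|q1 - p1| `|q0 - p0|.
  move=> p01 q01 mm; apply: bell_separatedN.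
  have := H (- p1) (- p0) (- q1) (- q0).
  have nE (a b : R) : `|- a - - b| = `|a - b| by rewrite -opprD normrN.
  rewrite !nE !lerN2 (distrC p0 p1) (distrC q0 q1).
  by apply => //; [exact: ltW|rewrite orbC].
wlog qp : p0 p1 q0 q1 l / q0 <= p0 => [H|].
  have [/H|qp] := leP q0 p0; first by apply.
  move=> p01 q01 mm; apply: bell_separatedC; rewrite maxC.
  by apply: H => //; [rewrite distrC (distrC p0)|exact: ltW|
    rewrite distrC (distrC p1)].
move=> p01 q01 mm.
have E0 : `|q0 - p0| = p0 - q0 by rewrite distrC ger0_norm//; lra.
apply: (@bell_separated_le (p0 - q0)).
- by rewrite le_max normr_ge0.
- by case/orP : mm => ?; lra.
have Ep : `|p1 - p0| = p1 - p0 by rewrite ger0_norm//; lra.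
have Eq : `|q1 - q0| = q1 - q0 by rewrite ger0_norm//; lra.
have := @bell_separated_sorted (p1 - p0) (p0 - q0) (q1 - p1) p0.
rewrite -E0 => /(_ _ l); rewrite E0.
rewrite (_ : p0 + (p1 - p0) = p1); last ring.
rewrite (_ : p0 - (p0 - q0) = q0); last ring.
rewrite (_ : p1 + (q1 - p1) = q1); last ring.
rewrite (_ : p1 - p0 + (p0 - q0) + (q1 - p1) = q1 - q0); last ring.
(* The second pair has the larger spread because [|q1 - p1| <= p0 - q0]. *)
rewrite Ep Eq max_r; first by apply; lra.
move: l; rewrite E0 ler_norml; lra.
Qed.

(** Sorting a pair may interchange the two matchings of the [p]s with the [q]s, hence a hypothesis
    on each matching. *)
Lemma bell_separated_all m p0 p1 q0 q1 :
  (m <= `|q0 - p0|) || (m <= `|q1 - p1|) ->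
  (m <= `|q0 - p1|) || (m <= `|q1 - p0|) ->
  bell_separated m (Num.max `|p1 - p0| `|q1 - q0|) p0 p1 q0 q1.
Proof.
wlog p01 : p0 p1 / p0 <= p1 => [H|].
  have [/H|/ltW p10] := leP p0 p1; first by apply.
  move=> m1 m2; apply: bell_separated_swapl; rewrite distrC.
  by apply: H.
wlog q01 : q0 q1 / q0 <= q1 => [H|].
  have [/H|/ltW p10] := leP q0 q1; first by apply.
  move=> m1 m2; apply/bell_separatedC/bell_separated_swapl/bell_separatedC.
  by rewrite (distrC q1); apply: H => //; rewrite orbC.
by move=> m1 _; exact: bell_separated_ordered.
Qed.

End one_dim.

(** * Gaussian integrals in R^n *)

Section gaussian_integral.
Context {R : realType}.
Local Open Scope ereal_scope.

Lemma integral_gauss1 (a m : R) : (0 < a)%R ->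
  \int[lebesgue_measure]_x (expR (- (a * (x - m) ^+ 2 / 2)))%:E =
  (Num.sqrt (2 * pi / a))%:E.
Proof.
move=> a0.
pose s := Num.sqrt a^-1.
have s0 : (0 < s)%R by rewrite sqrtr_gt0 invr_gt0.
have s2 : (s ^+ 2 = a^-1)%R by rewrite sqr_sqrtr// invr_ge0 ltW.
have pk0 : (0 < normal_peak s)%R by rewrite normal_peak_gt0// gt_eqF.
have pkE : ((normal_peak s)^-1 = Num.sqrt (2 * pi / a))%R.
  by rewrite /normal_peak invrK s2; congr Num.sqrt; ring.
transitivity (\int[lebesgue_measure]_x
    ((Num.sqrt (2 * pi / a))%:E * (normal_pdf m s x)%:E)).
  apply: eq_integral => x _; rewrite normal_pdfE ?gt_eqF//=.
  rewrite -EFinM -pkE mulKf ?gt_eqF// /normal_fun s2.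
  by congr (expR _)%:E; field; rewrite gt_eqF.
rewrite ge0_integralZl_EFin//.
- by rewrite integral_normal_pdf mule1.
- by move=> x _; rewrite lee_fin normal_pdf_ge0.
- by apply/measurable_EFinP; exact: measurable_normal_pdf.
Qed.

Lemma integral_lebesgue_RnS n (f : Rtuple R n.+1 -> \bar R) :
  measurable_fun [set: _] f -> (forall x, 0 <= f x) ->
  \int[lebesgue_Rn n.+1]_x f x =
  \int[lebesgue_Rn n]_y \int[lebesgue_measure]_x f (tuple_cons (x, y)).
Proof.
move=> mf f0.
rewrite /= (@ge0_integral_pushforward _ _ _ _ _ _ (@measurable_tuple_cons R n))//.
rewrite preimage_setT fubini_tonelli2//; last by move=> x; exact: f0.
by apply: measurableT_comp => //; exact: measurable_tuple_cons.
Qed.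

Definition colt n (x : Rtuple R n) : 'cV[R]_n := (\col_i tnth x i)%R.

Lemma qformE n (A : 'M[R]_n) (u : 'cV[R]_n) :
  qform A u = (\sum_i \sum_j u i 0 * A i j * u j 0)%R.
Proof.
rewrite /qform mxE exchange_big/=; apply: eq_bigr => j _.
rewrite mxE mulr_suml; apply: eq_bigr => i _.
by rewrite mxE.
Qed.

Lemma measurable_qform n (A : 'M[R]_n) (v : 'cV[R]_n) :
  measurable_fun [set: Rtuple R n] (fun x => qform A (colt x - v)).
Proof.
have mt i : measurable_fun [set: Rtuple R n] (fun x => (colt x - v) i 0)%R.
  rewrite (_ : (fun _ => _) = (fun x => tnth x i - v i 0)%R).
    by apply: measurable_funB => //; exact: measurable_tnth.
  by apply/funext => x; rewrite !mxE.
rewrite (_ : (fun x => _) =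
  (fun x => \sum_i \sum_j (colt x - v) i 0 * A i j * (colt x - v) j 0)%R).
  apply: measurable_sum => i; apply: measurable_sum => j.
  by apply: measurable_funM => //; apply: measurable_funM.
by apply/funext => x; exact: qformE.
Qed.

Definition gauss_kernel n (A : 'M[R]_n) (v : 'cV[R]_n) (x : Rtuple R n) : R :=
  expR (- (qform A (colt x - v) / 2)).

Lemma measurable_gauss_kernel n (A : 'M[R]_n) (v : 'cV[R]_n) :
  measurable_fun [set: Rtuple R n] (gauss_kernel A v).
Proof.
apply: measurableT_comp => //; apply: measurableT_comp => //.
by apply: measurable_funM => //; exact: measurable_qform.
Qed.

End gaussian_integral.

(** * Schur complements and the integral of a Gaussian kernel *)

Section schur_complement.
Context {R : realType}.
Implicit Types n : nat.

Lemma posdefmx00_gt0 n (A : 'M[R]_n.+1) : posdefmx A -> 0 < A 0 0.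
Proof.
move=> [_ /(_ (delta_mx 0 0))].
rewrite /qform trmx_delta -rowE -colE !mxE; apply.
apply/eqP => /matrixP/(_ 0 0); rewrite !mxE !eqxx/= => /eqP.
by rewrite oner_eq0.
Qed.

Definition schur n (A : 'M[R]_n.+1) : 'M[R]_n :=
  \matrix_(i, j) (A (lift 0 i) (lift 0 j) -
    (A 0 0)^-1 * (A (lift 0 i) 0 * A 0 (lift 0 j))).

(** One step of block elimination: [A] is a unit lower triangular block matrix times an upper
    triangular one with diagonal blocks [A 0 0] and [schur A]. *)
Lemma det_schur n (A : 'M[R]_n.+1) : A 0 0 != 0 ->
  \det A = A 0 0 * \det (schur A).
Proof.
move=> A00.
pose B : 'M[R]_(1 + n) := A.
have -> : \det A = \det (block_mx 1%:M 0 ((A 0 0)^-1 *: dlsubmx B) 1%:M *m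
    block_mx (ulsubmx B) (ursubmx B) 0 (schur A)).
  rewrite mulmx_block !mul1mx !mul0mx !addr0.
  have -> : ((A 0 0)^-1 *: dlsubmx B) *m ulsubmx B = dlsubmx B.
    rewrite [X in _ *m X]mx11_scalar mul_mx_scalar scalerA.
    have -> : ulsubmx B 0 0 = A 0 0.
      by rewrite !mxE; congr (A _ _); apply/val_inj.
    by rewrite mulfV// scale1r.
  have -> : ((A 0 0)^-1 *: dlsubmx B) *m ursubmx B + schur A = drsubmx B.
    apply/matrixP => i j; rewrite !mxE big_ord1 !mxE.
    by rewrite !rshift1 lshift0 -mulrA addrC subrK.
  by rewrite submxK.
rewrite det_mulmx det_lblock det_ublock !det1 !mul1r det_mx11.
by congr (_ * _); rewrite !mxE; congr (A _ _); apply/val_inj.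
Qed.

Definition cons_col n (s : R) (u : 'cV[R]_n) : 'cV[R]_n.+1 :=
  \col_i oapp (fun j => u j 0) s (unlift 0 i).

Lemma cons_col0 n s (u : 'cV[R]_n) : cons_col s u 0 0 = s.
Proof. by rewrite mxE unlift_none. Qed.

Lemma cons_colS n s (u : 'cV[R]_n) i : cons_col s u (lift 0 i) 0 = u i 0.
Proof. by rewrite mxE liftK. Qed.

(** Completes the square in the first coordinate [s]. *)
Lemma qform_schur n (A : 'M[R]_n.+1) (s : R) (u : 'cV[R]_n) :
  A^T = A -> A 0 0 != 0 ->
  qform A (cons_col s u) =
  A 0 0 * (s + (A 0 0)^-1 * \sum_j A 0 (lift 0 j) * u j 0) ^+ 2 +
  qform (schur A) u.
Proof.
move=> sA A00; set t := \sum_j _.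
have t' : \sum_i u i 0 * A (lift 0 i) 0 = t.
  by apply: eq_bigr => i _; rewrite -{1}sA mxE mulrC.
have -> : qform (schur A) u = \sum_i \sum_j u i 0 * A (lift 0 i) (lift 0 j) *
    u j 0 - (A 0 0)^-1 * (t * t).
  rewrite -{1}t' /t mulr_suml mulr_sumr -sumrB qformE; apply: eq_bigr => i _.
  rewrite !mulr_sumr -sumrB; apply: eq_bigr => j _.
  by rewrite mxE; ring.
rewrite qformE; under eq_bigr do rewrite big_ord_recl.
rewrite big_split/= !big_ord_recl/= !cons_col0.
under [\sum_(i < n) (_ * _ * s)]eq_bigr do rewrite cons_colS.
rewrite -mulr_suml t'.
under [\sum_(i < n) (s * _ * _)]eq_bigr do rewrite cons_colS -mulrA.
rewrite -mulr_sumr -/t.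
under [\sum_(i < n) \sum_(j < n) _]eq_bigr do
  under eq_bigr do rewrite !cons_colS.
by field.
Qed.

(** At the first coordinate that cancels the square in [qform_schur], the form of [A] takes the
    value of the form of [schur A]. *)
Lemma posdefmx_schur n (A : 'M[R]_n.+1) : posdefmx A -> posdefmx (schur A).
Proof.
move=> pA; have a0 := posdefmx00_gt0 pA; have [sA qA] := pA; split.
  have sE i j : A i j = A j i by rewrite -{1}sA mxE.
  apply/matrixP => i j; rewrite !mxE (sE (lift 0 j) (lift 0 i)).
  by rewrite (sE (lift 0 j) 0) (sE 0 (lift 0 i)) (mulrC (A 0 _)).
move=> u u0.
pose s := - ((A 0 0)^-1 * \sum_j A 0 (lift 0 j) * u j 0).
have := qform_schur s u sA; rewrite gt_eqF// addNr expr0n/= mulr0 add0r => <-//.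
apply: qA; apply: contra_neq u0 => c0.
by apply/matrixP => i j; rewrite ord1 -[LHS](cons_colS s u) c0 !mxE.
Qed.

Lemma det_posdefmx n (A : 'M[R]_n) : posdefmx A -> 0 < \det A.
Proof.
elim: n A => [A _|n IH A pA]; first by rewrite det_mx00.
have a0 := posdefmx00_gt0 pA.
by rewrite det_schur ?gt_eqF// mulr_gt0// IH//; exact: posdefmx_schur.
Qed.

Lemma colt_cons n (x : R) (y : Rtuple R n) (v : 'cV[R]_n.+1) :
  colt (tuple_cons (x, y)) - v =
  cons_col (x - v 0 0) (colt y - \col_i v (lift 0 i) 0).
Proof.
apply/matrixP => i j; rewrite ord1.
case: (unliftP 0 i) => [k ->|->].
  by rewrite cons_colS !mxE tnthS.
by rewrite cons_col0 !mxE tnth0.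
Qed.

(** Induction on the dimension: completing the square, the first coordinate integrates to
    [sqrt (2 pi / A 0 0)] whatever its shift, and the kernel of [schur A] remains. *)
Lemma integral_gauss_kernel n (A : 'M[R]_n) (v : 'cV[R]_n) : posdefmx A ->
  (\int[lebesgue_Rn n]_x (gauss_kernel A v x)%:E)%E =
  (Num.sqrt ((2 * pi) ^+ n / \det A))%:E.
Proof.
elim: n A v => [A v _|n IH A v pA].
  rewrite /= integral_dirac//=; last first.
    by apply/measurable_EFinP; exact: measurable_gauss_kernel.
  rewrite diracT mul1e /gauss_kernel qformE big_ord0 mul0r oppr0 expR0.
  by rewrite det_mx00 divr1 sqrtr1.
have a0 := posdefmx00_gt0 pA; have [sA _] := pA.
rewrite integral_lebesgue_RnS; last 2 first.
- by apply/measurable_EFinP; exact: measurable_gauss_kernel.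
- by move=> x; rewrite lee_fin expR_ge0.
pose v' : 'cV[R]_n := \col_i v (lift 0 i) 0.
pose c y := (A 0 0)^-1 * \sum_j A 0 (lift 0 j) * (colt y - v') j 0.
transitivity (\int[lebesgue_Rn n]_y
    ((Num.sqrt (2 * pi / A 0 0))%:E * (gauss_kernel (schur A) v' y)%:E))%E.
  apply: eq_integral => y _.
  transitivity (\int[lebesgue_measure]_x ((gauss_kernel (schur A) v' y)%:E *
      (expR (- (A 0 0 * (x - (v 0 0 - c y)) ^+ 2 / 2)))%:E))%E.
    apply: eq_integral => x _; rewrite -EFinM -expRD /gauss_kernel; congr EFin.
    rewrite colt_cons qform_schur// ?gt_eqF// -/v' -/(c y).
    by congr expR; ring.
  rewrite ge0_integralZl_EFin//; last 2 first.
  - apply/measurable_EFinP; apply: measurableT_comp => //.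
    apply: measurableT_comp => //; apply: measurable_funM => //.
    apply: measurable_funM => //; apply: measurable_funX.
    exact: measurable_funB.
  - exact: expR_ge0.
  by rewrite integral_gauss1// muleC.
rewrite ge0_integralZl_EFin//; last 2 first.
- by move=> x _; rewrite lee_fin expR_ge0.
- by apply/measurable_EFinP; exact: measurable_gauss_kernel.
have pS := posdefmx_schur pA.
rewrite IH// -EFinM -sqrtrM; last by rewrite divr_ge0 ?mulr_ge0 ?pi_ge0// ltW.
by rewrite det_schur ?gt_eqF// exprS invfM mulrACA.
Qed.

End schur_complement.

(** * Expectation of a Gaussian bump under a Gaussian law *)

Section gaussian_expectation.
Context {R : realType}.
Implicit Types n : nat.

Definition dot n (u v : 'cV[R]_n) : R := (u^T *m v) 0 0.

Lemma dotE n (u v : 'cV[R]_n) : dot u v = \sum_i u i 0 * v i 0.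
Proof. by rewrite /dot mxE; apply: eq_bigr => i _; rewrite mxE. Qed.

Lemma dotC n (u v : 'cV[R]_n) : dot u v = dot v u.
Proof. by rewrite !dotE; apply: eq_bigr => i _; rewrite mulrC. Qed.

Lemma dotDr n (u v w : 'cV[R]_n) : dot u (v + w) = dot u v + dot u w.
Proof. by rewrite /dot mulmxDr mxE. Qed.

Lemma dotZr n a (u v : 'cV[R]_n) : dot u (a *: v) = a * dot u v.
Proof. by rewrite /dot -scalemxAr mxE. Qed.

Lemma dotBr n (u v w : 'cV[R]_n) : dot u (v - w) = dot u v - dot u w.
Proof. by rewrite dotDr -scaleN1r dotZr mulN1r. Qed.

Lemma dotDl n (u v w : 'cV[R]_n) : dot (v + w) u = dot v u + dot w u.
Proof. by rewrite dotC dotDr !(dotC u). Qed.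

Lemma dotZl n a (u v : 'cV[R]_n) : dot (a *: v) u = a * dot v u.
Proof. by rewrite dotC dotZr dotC. Qed.

Lemma dotBl n (u v w : 'cV[R]_n) : dot (v - w) u = dot v u - dot w u.
Proof. by rewrite dotC dotBr !(dotC u). Qed.

Lemma qform_dot n (A : 'M[R]_n) u : qform A u = dot u (A *m u).
Proof. by rewrite /qform /dot mulmxA. Qed.

Lemma dot_mulmxl n (A : 'M[R]_n) u v : dot (A *m u) v = dot u (A^T *m v).
Proof. by rewrite /dot trmx_mul mulmxA. Qed.

(** Matrix determinant lemma: both sides come from triangular factorisations of the block matrix
    with rows [1, - y^T] and [x, 1]. *)
Lemma det_1Dmulmx n (x y : 'cV[R]_n) :
  \det (1%:M + x *m y^T) = 1 + dot y x.
Proof.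
have E : block_mx (1%:M : 'M[R]_1) 0 x 1%:M *m
    block_mx 1%:M (- y^T) 0 (1%:M + x *m y^T) =
    block_mx 1%:M (- y^T) 0 1%:M *m
    block_mx (1%:M + y^T *m x) 0 x 1%:M.
  rewrite !mulmx_block !(mul1mx, mulmx1, mul0mx, mulmx0, addr0, add0r).
  by rewrite mulNmx addrK mulmxN addrC addrK.
have := congr1 (@determinant _ _) E.
rewrite !det_mulmx !det_lblock !det_ublock !det1 !mul1r !mulr1 => ->.
by rewrite det_mx11 !mxE eqxx /dot mxE.
Qed.

Lemma posdefmx_unit n (A : 'M[R]_n) : posdefmx A -> A \in unitmx.
Proof. by move=> pA; rewrite unitmxE unitfE gt_eqF// det_posdefmx. Qed.

Lemma posdefmx_inv n (A : 'M[R]_n) : posdefmx A -> posdefmx (invmx A).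
Proof.
move=> pA; have uA := posdefmx_unit pA; have [sA qA] := pA; split.
  by rewrite trmx_inv sA.
move=> u u0; have Eu : u = A *m (invmx A *m u) by rewrite mulKVmx.
have -> : qform (invmx A) u = qform A (invmx A *m u).
  by rewrite !qform_dot -Eu dotC.
by apply: qA; apply: contra_neq u0 => v0; rewrite Eu v0 mulmx0.
Qed.

(* With [s = 1 - w^T S w] this is the precision matrix of the product of the
   density of [N(mu, S)] and the function [exp (- (w^T x - c)^2 / (2 s))]. *)
Definition tilt n (S : 'M[R]_n) (w : 'cV[R]_n) (s : R) : 'M[R]_n :=
  invmx S + s^-1 *: (w *m w^T).

Lemma qform_tilt n (S : 'M[R]_n) w s u :
  qform (tilt S w s) u = qform (invmx S) u + s^-1 * dot w u ^+ 2.
Proof.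
rewrite !qform_dot /tilt mulmxDl dotDr -scalemxAl dotZr -mulmxA.
congr (_ + _ * _); rewrite [w^T *m u]mx11_scalar mul_mx_scalar dotZr.
by rewrite -/(dot w u) (dotC u).
Qed.

Lemma posdefmx_tilt n (S : 'M[R]_n) w s : posdefmx S -> 0 < s ->
  posdefmx (tilt S w s).
Proof.
move=> pS s0; have [sI qI] := posdefmx_inv pS; split.
  by rewrite /tilt linearD linearZ/= sI trmx_mul trmxK.
move=> u u0; rewrite qform_tilt ltr_wpDr ?qI//.
by rewrite mulr_ge0 ?sqr_ge0// invr_ge0 ltW.
Qed.

(** With [invmx S] factored out, a rank-one perturbation of the identity remains, of determinant
    [1 + q / (1 - q) = 1 / (1 - q)] for [q = qform S w]. *)
Lemma det_tilt n (S : 'M[R]_n) w : posdefmx S -> qform S w < 1 ->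
  \det (tilt S w (1 - qform S w)) = (\det S * (1 - qform S w))^-1.
Proof.
move=> pS q1; set s := 1 - qform S w.
have s0 : 0 < s by rewrite subr_gt0.
have uS := posdefmx_unit pS.
have -> : tilt S w s = invmx S *m (1%:M + (s^-1 *: (S *m w)) *m w^T).
  by rewrite /tilt mulmxDr mulmx1 -scalemxAl -scalemxAr !mulmxA mulVmx// mul1mx.
rewrite det_mulmx det_inv det_1Dmulmx dotZr -qform_dot invfM; congr (_ * _).
by rewrite /s; field; rewrite gt_eqF.
Qed.

(** Completes the square in the product of density and bump. The constant is [k^2 / (q + s)] with
    [q = qform S w], and [q + s = 1]. *)
Lemma qform_tilt_center n (S : 'M[R]_n) w (k : R) u :
  posdefmx S -> qform S w < 1 ->
  let s := 1 - qform S w in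
  qform (tilt S w s) (u - k *: (S *m w)) =
  qform (invmx S) u + (dot w u - k) ^+ 2 / s - k ^+ 2.
Proof.
move=> pS q1 s; have s0 : s != 0 by rewrite gt_eqF// subr_gt0.
have uS := posdefmx_unit pS; have [sI _] := posdefmx_inv pS.
rewrite qform_tilt dotBr dotZr -qform_dot !(qform_dot (invmx S)).
rewrite mulmxBr -scalemxAr mulKmx// !dotBl !dotBr !dotZr !dotZl.
rewrite (dotC (S *m w) (invmx S *m u)) (dot_mulmxl (invmx S)) sI mulKmx//.
rewrite (dotC u w) (dotC (S *m w)) -qform_dot -qform_dot.
by rewrite /s; field.
Qed.

Lemma measurable_bell_test n (w : 'cV[R]_n) (c s : R) :
  measurable_fun [set: Rtuple R n]
    (fun x => expR (- ((dot w (colt x) - c) ^+ 2 / s / 2))).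
Proof.
apply: measurableT_comp => //; apply: measurableT_comp => //.
apply: measurable_funM => //; apply: measurable_funM => //.
apply: measurable_funX; apply: measurable_funB => //.
rewrite (_ : (fun x => _) = (fun x => \sum_i w i 0 * tnth x i)).
  apply: measurable_sum => i; apply: measurable_funM => //.
  exact: measurable_tnth.
by apply/funext => x; rewrite dotE; apply: eq_bigr => i _; rewrite mxE.
Qed.

Lemma measurable_gaussian_pdf n (mu : 'cV[R]_n) S :
  measurable_fun [set: Rtuple R n] (fun x => gaussian_pdf mu S (colt x)).
Proof.
by apply: measurable_funM => //; exact: measurable_gauss_kernel.
Qed.

Lemma gaussian_pdf_ge0 n (mu : 'cV[R]_n) S x : 0 <= gaussian_pdf mu S x.
Proof. by rewrite mulr_ge0 ?invr_ge0 ?sqrtr_ge0// expR_ge0. Qed.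

(** The integrand is a constant times a Gaussian kernel with precision matrix [tilt S w s];
    [det_tilt] makes the normalisations cancel up to [sqrt s]. *)
Lemma integral_bell_test n (mu : 'cV[R]_n) S w c :
  posdefmx S -> qform S w < 1 ->
  let s := 1 - qform S w in
  (\int[lebesgue_Rn n]_x (expR (- ((dot w (colt x) - c) ^+ 2 / s / 2)) *
     gaussian_pdf mu S (colt x))%:E)%E =
  (Num.sqrt s * bell (dot w mu - c))%:E.
Proof.
move=> pS q1 s; have s0 : 0 < s by rewrite subr_gt0.
pose k := c - dot w mu.
set Z := Num.sqrt ((2 * pi) ^+ n * \det S).
have dS := det_posdefmx pS.
have pin : 0 < (2 * pi : R) ^+ n by rewrite exprn_gt0// mulr_gt0// pi_gt0.
have Z0 : 0 < Z by rewrite sqrtr_gt0 mulr_gt0.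
transitivity (\int[lebesgue_Rn n]_x ((Z^-1 * bell (dot w mu - c))%:E *
    (gauss_kernel (tilt S w s) (mu + k *: (S *m w)) x)%:E))%E.
  apply: eq_integral => x _; rewrite -EFinM; congr EFin.
  rewrite /gaussian_pdf -/Z mulrCA -[RHS]mulrA; congr (_ * _).
  rewrite /bell /gauss_kernel -!expRD; congr expR.
  rewrite opprD addrA qform_tilt_center// -/s.
  rewrite (_ : dot w (colt x - mu) - k = dot w (colt x) - c); last first.
    by rewrite dotBr /k; ring.
  by rewrite /k -/(colt x); field; rewrite gt_eqF.
rewrite ge0_integralZl_EFin//.
- rewrite integral_gauss_kernel; last exact: posdefmx_tilt.
  rewrite det_tilt// -/s -EFinM; congr EFin.
  rewrite invrK mulrA sqrtrM ?mulr_ge0 ?ltW// -/Z.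
  by field; rewrite gt_eqF.
- by move=> x _; rewrite lee_fin expR_ge0.
- by apply/measurable_EFinP; exact: measurable_gauss_kernel.
- by rewrite mulr_ge0 ?invr_ge0 ?ltW// bell_gt0.
Qed.

(** For [w = 0] and [c = 0] the bump is the constant 1. *)
Lemma integral_gaussian_pdf n (mu : 'cV[R]_n) S : posdefmx S ->
  (\int[lebesgue_Rn n]_x (gaussian_pdf mu S (colt x))%:E)%E = 1%E.
Proof.
move=> pS.
have q0 : qform S 0 = 0 by rewrite /qform mulmx0 mxE.
have q1 : qform S 0 < 1 by rewrite q0 ltr01.
have d0 (u : 'cV[R]_n) : dot 0 u = 0 by rewrite -(scale0r u) dotZl mul0r.
have := integral_bell_test mu 0 pS q1.
rewrite /= q0 !subr0 sqrtr1 mul1r d0 (_ : bell 0 = 1); last first.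
  by rewrite /bell expr0n/= mul0r oppr0 expR0.
move=> <-; apply: eq_integral => x _.
by rewrite d0 subr0 expr0n/= !mul0r oppr0 expR0 mul1r.
Qed.

End gaussian_expectation.

(** * Lower bounds on the total variation distance *)

Section tv_dist_test.
Context {R : realType} {disp : measure_display} {T : measurableType disp}.
Variable mu : {measure set T -> \bar R}.
Implicit Types f g h : T -> R.
Local Open Scope ereal_scope.

Definition density f (A : set T) : \bar R := \int[mu]_(x in A) (f x)%:E.

(** Among functions with values in [0, 1], the indicator of the set where [g < f] maximises the
    integral against [f - g]. *)
Lemma tv_dist_ge_test f g h :
  measurable_fun [set: T] f -> measurable_fun [set: T] g ->
  measurable_fun [set: T] h ->
  (forall x, (0 <= f x)%R) -> (forall x, (0 <= g x)%R) ->
  (forall x, (0 <= h x <= 1)%R) ->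
  \int[mu]_x (f x)%:E < +oo -> \int[mu]_x (g x)%:E < +oo ->
  \int[mu]_x (h x * f x)%:E - \int[mu]_x (h x * g x)%:E <=
  tv_dist (density f) (density g).
Proof.
move=> mf mg mh f0 g0 h01 f1 g1.
have h0 x : (0 <= h x)%R by case/andP : (h01 x).
have h1 x : (h x <= 1)%R by case/andP : (h01 x).
pose A := [set x | (g x < f x)%R].
have mA : measurable A.
  by rewrite -[A]setTI; exact: (measurable_fun_ltr mg mf).
apply: (@le_trans _ _ (density f A - density g A)); last first.
  by apply: ereal_sup_ubound; exists A.
have mu_fin (k : T -> R) : measurable_fun [set: T] k ->
    (forall x, (0 <= k x <= g x)%R) ->
    \int[mu]_x (k x)%:E \is a fin_num.
  move=> mk k01; rewrite ge0_fin_numE; last first.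
    by apply: integral_ge0 => x _; rewrite lee_fin; case/andP : (k01 x).
  apply: le_lt_trans g1; apply: ge0_le_integral => //.
  - by move=> x _; rewrite lee_fin; case/andP : (k01 x).
  - exact/measurable_EFinP.
  - exact/measurable_EFinP.
  - by move=> x _; rewrite lee_fin; case/andP : (k01 x).
have dE k : density k A = \int[mu]_x (\1_A x * k x)%:E.
  rewrite /density integral_mkcond; apply: eq_integral => x _.
  by rewrite patchE indicE; case: ifPn => _; rewrite ?mul1r ?mul0r.
have mI : measurable_fun [set: T] (\1_A : T -> R) by exact: measurable_indic.
have I01 x : (0 <= (\1_A x : R) <= 1)%R.
  by rewrite indicE; case: (x \in A); rewrite /= ?lexx ler01.
rewrite !dE.
have mIf : measurable_fun [set: T] (fun x => \1_A x * f x)%R.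
  exact: measurable_funM.
have mIg : measurable_fun [set: T] (fun x => \1_A x * g x)%R.
  exact: measurable_funM.
have mhf : measurable_fun [set: T] (fun x => h x * f x)%R by exact: measurable_funM.
have mhg : measurable_fun [set: T] (fun x => h x * g x)%R by exact: measurable_funM.
have Ig : \int[mu]_x (\1_A x * g x)%:E \is a fin_num.
  apply: mu_fin => // x; have /andP[i0 i1] := I01 x.
  by rewrite mulr_ge0//= ler_piMl.
have hg : \int[mu]_x (h x * g x)%:E \is a fin_num.
  by apply: mu_fin => // x; rewrite mulr_ge0//= ler_piMl.
(* Moving the finite subtracted integrals across leaves a comparison of integrals of nonnegative
   functions, which then holds pointwise. *)
rewrite leeBlDr// addeAC leeBrDr//.
have nn k l : (forall x, 0 <= k x)%R -> (forall x, 0 <= l x)%R ->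
    forall x, [set: T] x -> 0 <= (k x * l x)%:E.
  by move=> k0 l0 x _; rewrite lee_fin mulr_ge0.
have I0 x : (0 <= (\1_A x : R))%R by case/andP : (I01 x).
rewrite -!ge0_integralD//; try exact: nn; try exact/measurable_EFinP.
apply: ge0_le_integral => //.
- by move=> x _; rewrite adde_ge0// lee_fin mulr_ge0.
- by apply: emeasurable_funD; exact/measurable_EFinP.
- by apply: emeasurable_funD; exact/measurable_EFinP.
move=> x _; rewrite -!EFinD lee_fin indicE.
case: (boolP (x \in A)) => [|]; rewrite ?inE /A/= => xA.
  rewrite !mul1r; have := h1 x; nra.
rewrite !mul0r; move/negP : xA; rewrite inE/= => /negP; rewrite -leNgt => xA.
have := h0 x; nra.
Qed.

(** [tv_dist] takes differences in one order only. If [a < b], testing with [1 - h] reverses the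
    sign, since both densities have mass 1. *)
Lemma tv_dist_ge_norm_test f g h (a b : R) :
  measurable_fun [set: T] f -> measurable_fun [set: T] g ->
  measurable_fun [set: T] h ->
  (forall x, (0 <= f x)%R) -> (forall x, (0 <= g x)%R) ->
  (forall x, (0 <= h x <= 1)%R) ->
  \int[mu]_x (f x)%:E = 1 -> \int[mu]_x (g x)%:E = 1 ->
  \int[mu]_x (h x * f x)%:E = a%:E -> \int[mu]_x (h x * g x)%:E = b%:E ->
  `|a - b|%:E <= tv_dist (density f) (density g).
Proof.
move=> mf mg mh f0 g0 h01 f1 g1 ha hb.
have h0 x : (0 <= h x)%R by case/andP : (h01 x).
have h1 x : (h x <= 1)%R by case/andP : (h01 x).
have [ab|ab] := leP b a.
  rewrite ger0_norm ?subr_ge0// EFinB -ha -hb.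
  by apply: tv_dist_ge_test => //; rewrite ?f1 ?g1 ltry.
pose h' x := (1 - h x)%R.
have mh' : measurable_fun [set: T] h' by exact: measurable_funB.
have compl (k : T -> R) (c : R) :
    measurable_fun [set: T] k -> (forall x, (0 <= k x)%R) ->
    \int[mu]_x (k x)%:E = 1 -> \int[mu]_x (h x * k x)%:E = c%:E ->
    \int[mu]_x (h' x * k x)%:E = (1 - c)%:E.
  move=> mk k0 k1 kc.
  have : \int[mu]_x (k x)%:E =
      \int[mu]_x (h' x * k x)%:E + \int[mu]_x (h x * k x)%:E.
    rewrite -ge0_integralD//.
    - by apply: eq_integral => x _; rewrite -EFinD /h'; congr EFin; ring.
    - by move=> x _; rewrite lee_fin mulr_ge0// /h' subr_ge0.
    - by apply/measurable_EFinP; exact: measurable_funM.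
    - by move=> x _; rewrite lee_fin mulr_ge0.
    - by apply/measurable_EFinP; exact: measurable_funM.
  by rewrite k1 kc EFinB => ->; rewrite addeK.
rewrite ltr0_norm ?subr_lt0//.
rewrite (_ : - (a - b) = (1 - a) - (1 - b))%R; last by ring.
rewrite EFinB -(compl _ _ mf f0 f1 ha) -(compl _ _ mg g0 g1 hb).
apply: tv_dist_ge_test => //; rewrite ?f1 ?g1 ?ltry// => x.
by rewrite /h' subr_ge0 h1 lerBlDr lerDl h0.
Qed.

End tv_dist_test.

(** * Two-component mixtures tested against a bump *)

Section mixtures.
Context {R : realType}.

Lemma eq_tv_dist disp (T : measurableType disp) (f f' g g' : set T -> \bar R) :
  (forall A, measurable A -> f A = f' A) ->
  (forall A, measurable A -> g A = g' A) -> tv_dist f g = tv_dist f' g'.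
Proof.
move=> ff gg; rewrite /tv_dist; congr ereal_sup; apply/seteqP.
by split=> _ [A mA <-]; exists A => //; rewrite (ff, gg)// (ff, gg)// gg.
Qed.

Definition mixture_pdf n (m0 m1 : 'cV[R]_n) S (x : Rtuple R n) : R :=
  2^-1 * gaussian_pdf m0 S (colt x) + 2^-1 * gaussian_pdf m1 S (colt x).

(** Taking [h = 1] gives the density of the mixture, taking a bump for [h] gives its expectation. *)
Lemma integral_mixture n (m0 m1 : 'cV[R]_n) S (A : set (Rtuple R n))
    (h : Rtuple R n -> R) :
  measurable A -> measurable_fun [set: Rtuple R n] h -> (forall x, 0 <= h x) ->
  (\int[lebesgue_Rn n]_(x in A) (h x * mixture_pdf m0 m1 S x)%:E =
   2^-1%:E * \int[lebesgue_Rn n]_(x in A) (h x * gaussian_pdf m0 S (colt x))%:E +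
   2^-1%:E * \int[lebesgue_Rn n]_(x in A) (h x * gaussian_pdf m1 S (colt x))%:E)%E.
Proof.
move=> mA mh h0.
have mg m : measurable_fun A (fun x => (h x * gaussian_pdf m S (colt x))%:E).
  apply/measurable_EFinP; apply: (@measurable_funS _ _ _ _ [set: _]) => //.
  by apply: measurable_funM => //; exact: measurable_gaussian_pdf.
have g0 m x : A x -> (0 <= (h x * gaussian_pdf m S (colt x))%:E)%E.
  by move=> _; rewrite lee_fin mulr_ge0// gaussian_pdf_ge0.
have Z m : (\int[lebesgue_Rn n]_(x in A)
    (2^-1%:E * (h x * gaussian_pdf m S (colt x))%:E) =
    2^-1%:E * \int[lebesgue_Rn n]_(x in A) (h x * gaussian_pdf m S (colt x))%:E)%E.
  by apply: ge0_integralZl_EFin; [|exact: g0|exact: mg|rewrite invr_ge0].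
transitivity (\int[lebesgue_Rn n]_(x in A)
    (2^-1%:E * (h x * gaussian_pdf m0 S (colt x))%:E +
     2^-1%:E * (h x * gaussian_pdf m1 S (colt x))%:E))%E.
  apply: eq_integral => x _; rewrite -!EFinM -EFinD /mixture_pdf.
  by congr EFin; ring.
have Zge0 m x : A x ->
    (0 <= 2^-1%:E * (h x * gaussian_pdf m S (colt x))%:E)%E.
  by move=> Ax; rewrite mule_ge0 ?g0// lee_fin invr_ge0.
transitivity (\int[lebesgue_Rn n]_(x in A)
      (2^-1%:E * (h x * gaussian_pdf m0 S (colt x))%:E) +
    \int[lebesgue_Rn n]_(x in A)
      (2^-1%:E * (h x * gaussian_pdf m1 S (colt x))%:E))%E.
  apply: ge0_integralD; [exact: mA|exact: Zge0| |exact: Zge0|];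
    by apply: measurable_funeM; exact: mg.
exact: (congr2 _ (Z m0) (Z m1)).
Qed.

Lemma gaussian_mixture2E n (m0 m1 : 'cV[R]_n) S A : measurable A ->
  gaussian_mixture2 m0 m1 S A = density (lebesgue_Rn n) (mixture_pdf m0 m1 S) A.
Proof.
move=> mA; pose h (_ : Rtuple R n) : R := 1.
have E (f : Rtuple R n -> R) : (\int[lebesgue_Rn n]_(x in A) (f x)%:E =
    \int[lebesgue_Rn n]_(x in A) (h x * f x)%:E)%E.
  by apply: eq_integral => x _; rewrite mul1r.
rewrite /density E integral_mixture//; last exact: measurable_cst.
by rewrite -(E (fun x => gaussian_pdf m0 S (colt x)))
  -(E (fun x => gaussian_pdf m1 S (colt x))).
Qed.

(* Testing the mixtures against a Gaussian bump in direction [w], of variance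
   [1 - qform S w]: convolving it with the projection of [N(mu, S)] yields
   variance 1 whatever [qform S w] is. *)
Lemma tv_mixture_ge_bell_gap n (S : 'M[R]_n) m0 m1 m0' m1' w c :
  posdefmx S -> qform S w <= 2^-1 ->
  ((4^-1 * `|bell_gap c (dot w m0) (dot w m1) (dot w m0') (dot w m1')|)%:E <=
   tv_dist (gaussian_mixture2 m0 m1 S) (gaussian_mixture2 m0' m1' S))%E.
Proof.
move=> pS q2; have q1 : qform S w < 1 by lra.
set s := 1 - qform S w; have s0 : 0 < s by rewrite subr_gt0.
pose h (x : Rtuple R n) := expR (- ((dot w (colt x) - c) ^+ 2 / s / 2)).
have h0 x : 0 <= h x by exact: expR_ge0.
have mh : measurable_fun [set: Rtuple R n] h by exact: measurable_bell_test.
have mm a b : measurable_fun [set: Rtuple R n] (mixture_pdf a b S).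
  by apply: measurable_funD; apply: measurable_funM => //;
    exact: measurable_gaussian_pdf.
have m_ge0 a b x : 0 <= mixture_pdf a b S x.
  by rewrite addr_ge0// mulr_ge0 ?invr_ge0 ?gaussian_pdf_ge0.
have m_int1 a b : (\int[lebesgue_Rn n]_x (mixture_pdf a b S x)%:E = 1)%E.
  transitivity (gaussian_mixture2 a b S [set: Rtuple R n]).
    by rewrite gaussian_mixture2E.
  rewrite /gaussian_mixture2 /gaussian !integral_gaussian_pdf// !mule1.
  by rewrite -EFinD; congr EFin; field.
have h_int a b : (\int[lebesgue_Rn n]_x (h x * mixture_pdf a b S x)%:E =
    (2^-1 * (Num.sqrt s * bell (dot w a - c)) +
     2^-1 * (Num.sqrt s * bell (dot w b - c)))%:E)%E.
  by rewrite integral_mixture// !integral_bell_test.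
rewrite (eq_tv_dist (@gaussian_mixture2E _ m0 m1 S)
  (@gaussian_mixture2E _ m0' m1' S)).
apply: le_trans (tv_dist_ge_norm_test (mm _ _) (mm _ _) mh (m_ge0 _ _)
  (m_ge0 _ _) _ (m_int1 _ _) (m_int1 _ _) (h_int _ _) (h_int _ _)); last first.
  move=> x; rewrite h0/= /h -expR0 ler_expR oppr_le0.
  by rewrite divr_ge0// divr_ge0 ?sqr_ge0// ltW.
rewrite lee_fin -[X in _ <= `|X|]opprK normrN.
rewrite (_ : - _ = Num.sqrt s / 2 * bell_gap c (dot w m0) (dot w m1)
  (dot w m0') (dot w m1')); last by rewrite /bell_gap; field.
rewrite normrM ler_wpM2r// ger0_norm ?divr_ge0 ?sqrtr_ge0//.
(* Indeed [s >= 1/2 >= 1/4]. *)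
suff : 2^-1 <= Num.sqrt s by lra.
by rewrite -[leLHS](@ger0_norm _ 2^-1)// -sqrtr_sqr ler_sqrt /s//; lra.
Qed.

Lemma tv_dist_ge0 n (m0 m1 m0' m1' : 'cV[R]_n) S :
  (0 <= tv_dist (gaussian_mixture2 m0 m1 S) (gaussian_mixture2 m0' m1' S))%E.
Proof.
apply: ereal_sup_ubound; exists set0; first exact: measurable0.
by rewrite /gaussian_mixture2 /gaussian !integral_set0 !mule0 !adde0 sube0.
Qed.

End mixtures.

(** * The projection direction *)

Section direction.
Context {R : realType} {d : nat}.
Implicit Types u v : 'cV[R]_d.

Lemma norm2_dot u : norm2 u ^+ 2 = dot u u.
Proof.
rewrite /norm2 sqr_sqrtr ?sumr_ge0// => [|i _]; last exact: sqr_ge0.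
by rewrite dotE; apply: eq_bigr => i _; rewrite expr2.
Qed.

Lemma norm2_ge0 u : 0 <= norm2 u. Proof. exact: sqrtr_ge0. Qed.

Lemma norm2_eq0 u : norm2 u = 0 -> u = 0.
Proof.
move=> u0; have : \sum_(i < d) u i 0 ^+ 2 = 0.
  rewrite -[LHS]sqr_sqrtr -?/(norm2 u) ?u0 ?expr0n// sumr_ge0// => i _.
  exact: sqr_ge0.
move/psumr_eq0P => H; apply/matrixP => i j; rewrite ord1 mxE.
by apply/eqP; rewrite -sqrf_eq0 H// => k _; exact: sqr_ge0.
Qed.

Lemma norm2Z (a : R) u : 0 <= a -> norm2 (a *: u) = a * norm2 u.
Proof.
move=> a0; apply/eqP; rewrite -(eqrXn2 (n := 2))// ?mulr_ge0 ?norm2_ge0//.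
by rewrite exprMn !norm2_dot dotZl dotZr mulrA expr2.
Qed.

Lemma dot_ge0 u : 0 <= dot u u.
Proof. by rewrite -norm2_dot sqr_ge0. Qed.

Lemma cauchy_schwarz u v : `|dot u v| <= norm2 u * norm2 v.
Proof.
rewrite -(ler_pXn2r (n := 2))// ?nnegrE ?mulr_ge0 ?norm2_ge0//.
rewrite real_normK ?num_real// exprMn !norm2_dot.
(* The component of [u] orthogonal to [v], multiplied by [dot v v] to avoid a division. *)
have := dot_ge0 (dot v v *: u - dot u v *: v).
rewrite !dotBl !dotBr !dotZl !dotZr (dotC v u) => H.
have [/eqP v0|v0] := eqVneq (norm2 v) 0.
  rewrite (norm2_eq0 (eqP v0)) -(scale0r v) !dotZr.
  by rewrite !mul0r expr0n/= mulr0.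
have vv : 0 < dot v v by rewrite -norm2_dot exprn_gt0// lt_def v0 norm2_ge0.
rewrite -(ler_pM2l vv); nra.
Qed.

(** When [k v] is a summand of [t], the vector [t - 2 k v] is [t] with the sign of that summand
    reversed. *)
Lemma dot_flip (k : R) v t :
  dot (t - (2 * k) *: v) (t - (2 * k) *: v) <= dot t t ->
  k ^+ 2 * dot v v <= k * dot v t.
Proof. by rewrite !dotBl !dotBr !dotZr !dotZl (dotC t v); lra. Qed.

(* Maximise the norm of [t = +- v1 / |v1| +- v2 / |v2| +- v3 / |v3|] over the
   signs: that no sign flip increases the norm is the claimed inequality. *)
Lemma common_direction v1 v2 v3 : exists t,
  [/\ t \in <<[:: v1; v2; v3]>>%VS, norm2 t <= 3,
      norm2 v1 <= `|dot v1 t|, norm2 v2 <= `|dot v2 t| &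
      norm2 v3 <= `|dot v3 t|].
Proof.
(* For [v = 0] the inverse is 0 by convention, so zero vectors fit in the same formula. *)
pose k (b : bool) v : R := (-1) ^+ b * (norm2 v)^-1.
pose t (b : bool * bool * bool) :=
  k b.1.1 v1 *: v1 + k b.1.2 v2 *: v2 + k b.2 v3 *: v3.
have kN b v : k (~~ b) v = - k b v.
  by rewrite /k; case: b; rewrite ?expr1 ?expr0 ?mulN1r ?mul1r ?opprK.
have k2 b v : k b v ^+ 2 * dot v v <= 1.
  rewrite /k exprMn sqrr_sign mul1r -norm2_dot -exprMn.
  have [->|v0] := eqVneq (norm2 v) 0; first by rewrite mulr0 expr0n ler01.
  by rewrite mulVf// expr1n.
pose b0 := [arg max_(b > (true, true, true)) dot (t b) (t b)]%O.
have tmax b : dot (t b) (t b) <= dot (t b0) (t b0).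
  by rewrite /b0; case: Order.TotalTheory.arg_maxP => // i _; apply.
have key b v : k b v ^+ 2 * dot v v <= k b v * dot v (t b0) ->
    norm2 v <= `|dot v (t b0)|.
  have [->|v0] := eqVneq (norm2 v) 0; first by rewrite normr_ge0.
  have v_gt0 : 0 < norm2 v by rewrite lt_def v0 norm2_ge0.
  rewrite /k exprMn sqrr_sign mul1r -norm2_dot -exprMn mulVf// expr1n => H.
  have := le_trans H (ler_norm _).
  rewrite !normrM normr_sign mul1r normfV (ger0_norm (norm2_ge0 v)) mulrC.
  by rewrite ler_pdivlMr// mul1r.
exists (t b0); split.
- by rewrite !rpredD// rpredZ// memv_span// !inE eqxx ?orbT.
- rewrite -(ler_pXn2r (n := 2))// ?nnegrE ?norm2_ge0// norm2_dot /t.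
  set x := _ *: v1; set y := _ *: v2; set z := _ *: v3.
  have x1 : dot x x <= 1 by rewrite dotZl dotZr mulrA -expr2.
  have y1 : dot y y <= 1 by rewrite dotZl dotZr mulrA -expr2.
  have z1 : dot z z <= 1 by rewrite dotZl dotZr mulrA -expr2.
  (* These bound the cross terms, giving [|x + y + z|^2 <= 3 (|x|^2 + |y|^2 + |z|^2) <= 9]. *)
  have := dot_ge0 (x - y); have := dot_ge0 (x - z); have := dot_ge0 (y - z).
  rewrite !(dotBl, dotBr, dotDl, dotDr) (dotC y x) (dotC z x) (dotC z y).
  lra.
- apply: (key b0.1.1); apply: dot_flip.
  suff <- : t (~~ b0.1.1, b0.1.2, b0.2) = t b0 - (2 * k b0.1.1 v1) *: v1 by [].
  by rewrite /t/= kN; apply/matrixP => i j; rewrite !mxE; ring.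
- apply: (key b0.1.2); apply: dot_flip.
  suff <- : t (b0.1.1, ~~ b0.1.2, b0.2) = t b0 - (2 * k b0.1.2 v2) *: v2 by [].
  by rewrite /t/= kN; apply/matrixP => i j; rewrite !mxE; ring.
- apply: (key b0.2); apply: dot_flip.
  suff <- : t (b0.1.1, b0.1.2, ~~ b0.2) = t b0 - (2 * k b0.2 v3) *: v3 by [].
  by rewrite /t/= kN; apply/matrixP => i j; rewrite !mxE; ring.
Qed.

(** By homogeneity it is enough to treat unit vectors; their coordinates are at most 1 in absolute
    value, so the supremum is over a bounded set. *)
Lemma max_qform_ge (A : 'M[R]_d) (U : {vspace 'cV[R]_d}) u : u \in U ->
  qform A u <= max_qform A U * norm2 u ^+ 2.
Proof.
move=> uU; have [u0|u0] := eqVneq (norm2 u) 0.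
  have -> : qform A u = 0 by rewrite (norm2_eq0 u0) /qform mulmx0 mxE.
  by rewrite u0 expr0n/= mulr0.
have ugt0 : 0 < norm2 u by rewrite lt_def u0 norm2_ge0.
pose w := (norm2 u)^-1 *: u.
have -> : qform A u = qform A w * norm2 u ^+ 2.
  rewrite !qform_dot /w -scalemxAr dotZr dotZl; field.
  by rewrite u0.
rewrite ler_pM2r ?exprn_gt0//; apply: ub_le_sup.
  exists (\sum_i \sum_j `|A i j|) => _ [x [_ x1] <-].
  have xle i : `|x i 0| <= 1.
    rewrite -(ler_pXn2r (n := 2))// ?nnegrE// real_normK ?num_real//.
    rewrite expr1n -[leRHS](expr1n _ 2) -x1 norm2_dot dotE (bigD1 i)//= -expr2.
    by rewrite lerDl sumr_ge0// => j _; rewrite -expr2 sqr_ge0.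
  rewrite qformE; apply: ler_sum => i _; apply: ler_sum => j _.
  apply: le_trans (ler_norm _) _; rewrite !normrM.
  rewrite -[leRHS]mul1r -[leRHS]mulr1 ler_pM// ?mulr_ge0//.
  by rewrite ler_wpM2r.
exists w => //; split; first by rewrite rpredZ.
by rewrite norm2Z ?invr_ge0 ?norm2_ge0// mulVf.
Qed.

End direction.

(** * From projected separations to total variation *)

Section projected.
Context {R : realType}.

Lemma tv_mixture_ge_separated n (S : 'M[R]_n) m0 m1 m0' m1' w m W :
  posdefmx S -> qform S w <= 2^-1 ->
  bell_separated m W (dot w m0) (dot w m1) (dot w m0') (dot w m1') ->
  let tv := tv_dist (gaussian_mixture2 m0 m1 S) (gaussian_mixture2 m0' m1' S) in
  let k := bell 4 / 16 in
  ((k * (Num.min 1 m * Num.min 1 W))%:E <= tv)%E /\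
  (W <= 3 / 2 * m -> ((k * Num.min 1 m)%:E <= tv)%E).
Proof.
move=> pS qw [c [H1 H2]] tv k.
have H := tv_mixture_ge_bell_gap m0 m1 m0' m1' c pS qw.
have kE x : k * x = 4^-1 * (bell 4 / 4 * x) by rewrite /k; field.
split => [|WM]; apply: le_trans H; rewrite lee_fin kE ler_pM2l ?invr_gt0//.
exact: H2.
Qed.

Lemma norm2_argmax n (S : set 'cV[R]_n) v (w : 'cV[R]_n) :
  argmax_norm2 S v -> forall s, S s -> `|dot w s| <= norm2 w * norm2 v.
Proof.
move=> [_ vmax] s Ss; apply: le_trans (cauchy_schwarz _ _) _.
by rewrite ler_wpM2l ?norm2_ge0// vmax.
Qed.

(* The simultaneous direction [t] of common_direction, scaled by
   [1 / (5 sqrt lambda)], makes the projected separations comparable with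
   [|v_i| / sqrt lambda] while keeping the projected variance below 1/2. *)
Lemma tv_mixture_ge n (S : 'M[R]_n) m0 m1 m0' m1' v1 v2 v3 :
  posdefmx S ->
  argmax_norm2 [set m1 - m0; m1' - m0'] v1 ->
  argmax_norm2 [set m0' - m0; m1' - m1] v2 ->
  argmax_norm2 [set m0' - m1; m1' - m0] v3 ->
  let lambda := max_qform S <<[:: v1; v2; v3]>>%VS in
  let a := norm2 v1 / Num.sqrt lambda in
  let m := Num.min (norm2 v2) (norm2 v3) / Num.sqrt lambda in
  let tv := tv_dist (gaussian_mixture2 m0 m1 S) (gaussian_mixture2 m0' m1' S) in
  let k := bell 4 / 16 in
  0 < lambda ->
  ((k * (Num.min 1 (m / 5) * Num.min 1 (a / 5)))%:E <= tv)%E /\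
  (a <= m / 2 -> ((k * Num.min 1 (m / 5))%:E <= tv)%E).
Proof.
move=> pS av1 av2 av3 lambda a m tv k l0.
have [t [tU t3 t1 t2 t3']] := common_direction v1 v2 v3.
set sl := Num.sqrt lambda in a m *.
have sl0 : 0 < sl by rewrite sqrtr_gt0.
have sl2 : sl ^+ 2 = lambda by rewrite sqr_sqrtr// ltW.
(* As [norm2 t <= 3], the factor 5 brings the projected variance below
   [(3 / 5)^2 = 9 / 25 <= 1 / 2]. *)
pose r := (5 * sl)^-1; have r0 : 0 < r by rewrite invr_gt0 mulr_gt0.
pose w := r *: t.
have qw : qform S w <= 2^-1.
  have -> : qform S w = r ^+ 2 * qform S t.
    by rewrite !qform_dot /w -scalemxAr dotZr dotZl mulrA expr2.
  have := max_qform_ge S tU; rewrite -/lambda -sl2 => H.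
  apply: (@le_trans _ _ (r ^+ 2 * (sl ^+ 2 * 3 ^+ 2))).
    rewrite ler_pM2l ?exprn_gt0//; apply: le_trans H _.
    by rewrite ler_pM2l ?exprn_gt0// ler_pXn2r ?nnegrE ?norm2_ge0.
  rewrite (_ : r ^+ 2 * _ = 9 / 25); first lra.
  by rewrite /r; field; rewrite gt_eqF.
have nw : norm2 w <= 3 / 5 / sl.
  rewrite /w norm2Z ?(ltW r0)//.
  apply: (@le_trans _ _ (r * 3)); first by rewrite ler_pM2l.
  by rewrite /r le_eqVlt; apply/orP; left; apply/eqP; field; rewrite gt_eqF.
have lower v : norm2 v <= `|dot v t| -> norm2 v / sl / 5 <= `|dot w v|.
  move=> H; rewrite /w dotZl normrM (gtr0_norm r0) dotC.
  rewrite (_ : _ / 5 = r * norm2 v); first by rewrite ler_pM2l.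
  by rewrite /r; field; rewrite gt_eqF.
have dB x y : dot w (x - y) = dot w x - dot w y by exact: dotBr.
set p0 := dot w m0; set p1 := dot w m1.
set q0 := dot w m0'; set q1 := dot w m1'.
pose W := Num.max `|p1 - p0| `|q1 - q0|.
have Wa : a / 5 <= W.
  rewrite /W le_max -!dB; case: av1 => -[] E _; rewrite -E /a.
    by rewrite (lower _ t1).
  by rewrite orbC (lower _ t1).
have W3 : W <= 3 / 5 * a.
  have -> : 3 / 5 * a = 3 / 5 / sl * norm2 v1 by rewrite /a; field; rewrite gt_eqF.
  rewrite /W ge_max -!dB; apply/andP; split.
    apply: le_trans (norm2_argmax w av1 _) _; first by left.
    by rewrite ler_wpM2r ?norm2_ge0.
  apply: le_trans (norm2_argmax w av1 _) _; first by right.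
  by rewrite ler_wpM2r ?norm2_ge0.
have ml v v' : m / 5 <= norm2 v / sl / 5 -> norm2 v <= `|dot v t| ->
    v = v' -> m / 5 <= `|dot w v'|.
  by move=> mv tv' <-; apply: le_trans mv _; exact: lower.
have m2 : m / 5 <= norm2 v2 / sl / 5.
  by rewrite /m !ler_pM2r ?invr_gt0// ge_min lexx.
have m3 : m / 5 <= norm2 v3 / sl / 5.
  by rewrite /m !ler_pM2r ?invr_gt0// ge_min lexx orbT.
have M2 : (m / 5 <= `|q0 - p0|) || (m / 5 <= `|q1 - p1|).
  rewrite -!dB; case: av2 => -[] E _; rewrite (ml _ _ m2 t2 E)//.
  by rewrite orbT.
have M3 : (m / 5 <= `|q0 - p1|) || (m / 5 <= `|q1 - p0|).
  rewrite -!dB; case: av3 => -[] E _; rewrite (ml _ _ m3 t3' E)//.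
  by rewrite orbT.
have [H1 H2] := tv_mixture_ge_separated pS qw (bell_separated_all M2 M3).
(* From [a <= m / 2] and [W <= 3/5 a] follows [W <= 3/2 (m / 5)], the condition of the linear
   bound. *)
split; last by move=> am; apply: H2; rewrite -/W; lra.
apply: le_trans H1; rewrite lee_fin ler_pM2l ?divr_gt0 ?bell_gt0// -/W.
have a0 : 0 <= a by rewrite divr_ge0 ?norm2_ge0// ltW.
have m_ge0 : 0 <= m by rewrite divr_ge0 ?(ltW sl0)// le_min !norm2_ge0.
rewrite ler_wpM2l//; last by rewrite le_min !ge_min lexx Wa orbT.
by rewrite le_min ler01 divr_ge0.
Qed.

End projected.

(** * Choice of the constant and case analysis *)

Lemma min1_scale {R : realType} (c x : R) : 0 <= x -> 0 <= c <= 1 ->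
  c * Num.min 1 x <= Num.min 1 (c * x).
Proof.
move=> x0 /andP[c0 c1]; rewrite le_min ler_wpM2l ?ge_min ?lexx ?orbT// andbT.
by rewrite mulr_ile1// ?ge_min ?lexx// le_min ler01.
Qed.

Theorem theorem1 (R : realType) (C : R) (C_gt0 : 0 < C) :
  exists2 c : R, 0 < c &
  forall (d : nat) (Sigma : 'M[R]_d) (mu0 mu1 mu0' mu1' : 'cV[R]_d)
    (v1 v2 v3 : 'cV[R]_d),
  (0 < d)%N ->
  posdefmx Sigma ->
  ~ (mu0 = mu1 /\ mu1 = mu0' /\ mu0' = mu1') ->
  argmax_norm2 [set mu1 - mu0; mu1' - mu0'] v1 ->
  argmax_norm2 [set mu0' - mu0; mu1' - mu1] v2 ->
  argmax_norm2 [set mu0' - mu1; mu1' - mu0] v3 ->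
  let lambda := max_qform Sigma <<[:: v1; v2; v3]>>%VS in
  let minv23 := Num.min (norm2 v2) (norm2 v3) in
  let tv := tv_dist (gaussian_mixture2 mu0 mu1 Sigma)
                    (gaussian_mixture2 mu0' mu1' Sigma) in
  let cond := 2^-1 * minv23 <= norm2 v1 /\
              C * norm2 v1 <= Num.sqrt lambda in
  (cond ->
     ((c * Num.min 1 (norm2 v1 * minv23 / lambda))%:E <= tv)%E) /\
  (~ cond ->
     ((c * Num.min 1 (minv23 / Num.sqrt lambda))%:E <= tv)%E).

Proof.
(* [g] serves in (i), where [a <= 1 / C] and [m <= 2 / C] for the rescaled norms [a] and [m]; [g']
   serves in (ii) when [a > 1 / C]. *)
pose g := Num.min 5^-1 (C / 2); pose g' := Num.min 1 (5 * C)^-1.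
have k0 : 0 < bell 4 / 16 :> R by rewrite divr_gt0 ?bell_gt0.
have g0 : 0 < g by rewrite lt_min invr_gt0 ltr0n divr_gt0.
have g'0 : 0 < g' by rewrite lt_min ltr01 invr_gt0 mulr_gt0.
have [g5 gC] : g <= 5^-1 /\ g <= C / 2 by rewrite /g !ge_min !lexx orbT.
have [g'1 g'C] : g' <= 1 /\ g' <= (5 * C)^-1 by rewrite /g' !ge_min !lexx orbT.
exists (bell 4 / 16 * (g ^+ 2 * g')).
  by rewrite mulr_gt0// mulr_gt0// exprn_gt0.
move=> d S m0 m1 m0' m1' v1 v2 v3 _ pS _ av1 av2 av3 lambda minv tv cond.
set k := bell 4 / 16 in k0 *.
have tv0 : (0 <= tv)%E := tv_dist_ge0 m0 m1 m0' m1' S.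
have c0 : 0 < k * (g ^+ 2 * g') by rewrite mulr_gt0// mulr_gt0// exprn_gt0.
have minv0 : 0 <= minv by rewrite le_min !norm2_ge0.
(* For [lambda <= 0] both right-hand sides are nonpositive: the first divides by [lambda], and in
   the second the square root and its inverse are 0. *)
have [l0|l0] := leP lambda 0.
  split => _; apply: le_trans tv0; rewrite lee_fin pmulr_rle0// ge_min.
    rewrite [X in _ || X]mulr_ge0_le0 ?orbT ?mulr_ge0 ?norm2_ge0//.
    by rewrite invr_le0.
  by rewrite ler0_sqrtr// invr0 mulr0 lexx orbT.
have [H1 H2] := tv_mixture_ge pS av1 av2 av3 l0.
have sl0 : 0 < Num.sqrt lambda by rewrite sqrtr_gt0.
set a := norm2 v1 / Num.sqrt lambda in H1 H2.
set m := _ / Num.sqrt _ in H1 H2; rewrite -/k -/tv in H1 H2.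
have a0 : 0 <= a by rewrite divr_ge0 ?norm2_ge0// ltW.
have m_ge0 : 0 <= m by rewrite divr_ge0// ltW.
have g2 : g ^+ 2 <= 5^-1 by nra.
have g2' : 0 < g ^+ 2 by rewrite exprn_gt0.
have mm : 5^-1 * Num.min 1 m <= Num.min 1 (m / 5).
  by rewrite (mulrC m) min1_scale// invr_ge0 ler0n invf_le1// ler1n.
have min0 : 0 <= Num.min 1 m by rewrite le_min ler01.
have aC : (C * norm2 v1 <= Num.sqrt lambda) = (C * a <= 1).
  by rewrite /a mulrA ler_pdivrMr// mul1r.
have am2 : (2^-1 * minv <= norm2 v1) = (m / 2 <= a).
  by rewrite /a /m -/minv mulrAC ler_pM2r ?invr_gt0// mulrC.
split.
  move=> []; rewrite am2 aC => ma Ca.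
  have -> : norm2 v1 * minv / lambda = a * m.
    rewrite /a /m -/minv -{1}(sqr_sqrtr (ltW l0)); field.
    by rewrite gt_eqF.
  apply: le_trans H1; rewrite lee_fin -mulrA ler_pM2l//.
  have ga : g * a <= Num.min 1 (a / 5).
    by rewrite le_min; apply/andP; split; nra.
  have gm : g * m <= Num.min 1 (m / 5).
    by rewrite le_min; apply/andP; split; nra.
  apply: (@le_trans _ _ ((g * m) * (g * a))); last first.
    by rewrite ler_pM// mulr_ge0// ltW.
  rewrite (_ : g * m * (g * a) = g ^+ 2 * (a * m)); last by ring.
  rewrite -mulrA ler_pM2l//; apply: (@le_trans _ _ (Num.min 1 (a * m))).
    by rewrite ler_piMl// le_min ler01 mulr_ge0.
  by rewrite ge_min lexx orbT.
move=> ncond; rewrite -/m.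
(* If [a <= m / 2] the linear bound applies. Otherwise the first condition of (i) holds, so the
   second fails and [a > 1 / C] bounds the spread factor from below. *)
have [am|am] := leP a (m / 2).
  apply: le_trans (H2 am); rewrite lee_fin -mulrA ler_pM2l//.
  by apply: le_trans mm; rewrite ler_wpM2r//; nra.
have Ca : 1 < C * a.
  by rewrite ltNge -aC; apply/negP => H; apply: ncond; rewrite /cond am2 (ltW am).
apply: le_trans H1; rewrite lee_fin -mulrA ler_pM2l//.
have ga : g' <= Num.min 1 (a / 5).
  rewrite le_min g'1/=; apply: le_trans g'C _.
  by rewrite invfM mulrC ler_pM2r ?invr_gt0// -[leLHS]mul1r ler_pdivrMr// mulrC ltW.
apply: (@le_trans _ _ (5^-1 * Num.min 1 m * g')).
  by rewrite mulrAC ler_pM2r// ler_wpM2r.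
by rewrite ler_pM// ?mulr_ge0// ltW.
Qed.
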